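(* Let $n$ be even and $f=\gamma_0+\sum_{i=1}^{n-1}a_i\gamma_{2i}$ with $a_i\in\mathbb{F}_2$. Then $f$ is a permutation of $\mathbb{F}_2^n$ if and only if $\big[1+\sum_{i=1}^{n-1}a_iX^i\big]$ is a unit in $\mathbb{F}_2[X]/(X^n+X^{n/2})$, equivalently if and only if, in $\mathbb{F}_2[X]$, $$\gcd\Big(1+\sum_{i=1}^{n-1}a_iX^i,\;1+X^{n/2}\Big)=\gcd\Big(1+\sum_{i=1}^{n-1}a_iX^i,\;1+X^m\Big)=1,$$ where $m$ is the largest odd divisor of $n$.
   Context: Let $\mathbbm{1}=(1,\dots,1)\in\mathbb{F}_2^n$, let $\odot$ denote component-wise multiplication in $\mathbb{F}_2^n$, and let $S(x_1,\dots,x_n)=(x_2,\dots,x_n,x_1)$. Define $\gamma_0=\mathrm{id}$ and, for $k\geq1$, $\gamma_{2k}(x)=S^{2k}(x)\odot(\mathbbm{1}+S^{2k-1}(x))\odot(\mathbbm{1}+S^{2k-3}(x))\odot\cdots\odot(\mathbbm{1}+S(x))$, as functions $\mathbb{F}_2^n\to\mathbb{F}_2^n$; sums of functions are pointwise. *)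

(* Defs.v *)
From HB Require Import structures.
From mathcomp Require Import all_boot all_order all_algebra.

Set Implicit Arguments.
Unset Strict Implicit.
Unset Printing Implicit Defensive.

Import GRing.Theory.
Local Open Scope ring_scope.

Definition ones (n : nat) : 'rV['F_2]_n := const_mx 1.

Definition odot (n : nat) (x y : 'rV['F_2]_n) : 'rV['F_2]_n :=
  map2_mx *%R x y.

Definition shift (n : nat) (x : 'rV['F_2]_n) : 'rV['F_2]_n :=
  \row_i x 0 (ordS i).

(* The index is halved: gamma_even k is gamma_{2k}. *)
Definition gamma_even (n k : nat) (x : 'rV['F_2]_n) : 'rV['F_2]_n :=
  if k is 0 then x
  else odot (iter (2 * k)%N (@shift n) x)
            (\big[@odot n/ones n]_(j < k)
               (ones n + iter (2 * j + 1)%N (@shift n) x)).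

Definition fmap (n : nat) (a : nat -> 'F_2) (x : 'rV['F_2]_n) : 'rV['F_2]_n :=
  gamma_even 0 x + \sum_(1 <= i < n) a i *: gamma_even i x.

Definition apoly (n : nat) (a : nat -> 'F_2) : {poly 'F_2} :=
  1 + \sum_(1 <= i < n) a i *: 'X^i.

Definition largest_odd_divisor (n : nat) : nat :=
  (\max_(d <- divisors n | odd d) d)%N.

(* Main.v *)
Require Import Defs.
From mathcomp Require Import all_boot all_order all_algebra zify ring.

(** Write [G p] for the map [sum_k p_k gamma_{2k}] attached to a polynomial [p].
    The point is that [G p o G q = G (p q)] as soon as [q(0) = 1], although the
    maps are far from linear: if [y = G q x], the factors [1 + y_j] occurring in
    [gamma_{2k} y] may be replaced by [1 + x_j], because a position where [y] and
    [x] differ sees its first one at even distance, and this forces the relevant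
    factor of [gamma_{2k} y] at odd distance to vanish.  For [n = 2h] periodicity
    gives [G ((X^n + X^h) p) = 0], so an inverse of [p] modulo [X^n + X^h] yields
    an inverse of [G p].  Conversely, on vectors supported on even positions [G p]
    is the circulant map of [p] modulo [X^h + 1], which is not injective when [p]
    and [X^h + 1] have a common factor. *)

Import GRing.Theory.
Set Implicit Arguments.
Unset Strict Implicit.
Unset Printing Implicit Defensive.
Local Open Scope ring_scope.

(** * Gaps and polynomial maps on sequences *)

Lemma F2_neq0 (x : 'F_2) : x != 0 -> x = 1.
Proof. by case: x => -[|[|m]] // ? _; apply/val_inj. Qed.

Lemma F2_1D_eq0 (x : 'F_2) : (1 + x == 0) = (x != 0).
Proof. by case: x => -[|[|m]]. Qed.

(** Sequences on [nat] stand in for rows, so that positions add without reduction modulo [n]. *)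
Definition gap (k : nat) (u : nat -> 'F_2) (i : nat) : 'F_2 :=
  \prod_(j < k) (1 + u (i + 2 * j + 1)%N).

Definition gamma_seq (k : nat) (u : nat -> 'F_2) (i : nat) : 'F_2 :=
  gap k u i * u (i + 2 * k)%N.

Definition poly_map (p : {poly 'F_2}) (u : nat -> 'F_2) (i : nat) : 'F_2 :=
  \sum_(k < size p) p`_k * gamma_seq k u i.

Lemma gapD k l u i : gap (k + l) u i = gap k u i * gap l u (i + 2 * k).
Proof.
rewrite /gap big_split_ord /=; congr (_ * _).
by apply: eq_bigr => j _; congr (1 + u _); lia.
Qed.

Lemma gapS k u i : gap k.+1 u i = (1 + u i.+1) * gap k u i.+2.
Proof.
rewrite -(add1n k) gapD /gap big_ord1 /= muln0 addn0 addn1.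
by congr (_ * _); apply: eq_bigr => j _; congr (1 + u _); lia.
Qed.

Lemma gap_neq0 k u i :
  gap k u i != 0 -> forall j, (j < k)%N -> u (i + 2 * j + 1)%N = 0.
Proof.
move=> /prodf_neq0 gap_nz j jk; apply/eqP.
by have := gap_nz (Ordinal jk) isT; rewrite F2_1D_eq0 negbK.
Qed.

Lemma gamma_seqD k l u i :
  gamma_seq (k + l) u i = gap k u i * gamma_seq l u (i + 2 * k).
Proof. by rewrite /gamma_seq gapD -mulrA mulnDr addnA. Qed.

Lemma poly_map_widen N (p : {poly _}) u i : (size p <= N)%N ->
  poly_map p u i = \sum_(k < N) p`_k * gamma_seq k u i.
Proof.
move=> sz; rewrite /poly_map (big_ord_widen N (fun k => p`_k * gamma_seq k u i)) //.
rewrite big_mkcond; apply: eq_bigr => k _; case: ltnP => // /(nth_default 0) ->.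
by rewrite mul0r.
Qed.

Lemma poly_mapD p q u i : poly_map (p + q) u i = poly_map p u i + poly_map q u i.
Proof.
pose N := maxn (size (p + q)) (maxn (size p) (size q)).
rewrite !(@poly_map_widen N) ?leq_max ?leqnn ?orbT // -big_split /=.
by apply: eq_bigr => k _; rewrite coefD mulrDl.
Qed.

Lemma poly_mapZ c p u i : poly_map (c *: p) u i = c * poly_map p u i.
Proof.
rewrite (poly_map_widen _ _ (size_scale_leq c p)) mulr_sumr.
by apply: eq_bigr => k _; rewrite coefZ mulrA.
Qed.

Lemma poly_map_sum (I : Type) (r : seq I) (P : pred I) (F : I -> {poly 'F_2}) u i :
  poly_map (\sum_(j <- r | P j) F j) u i = \sum_(j <- r | P j) poly_map (F j) u i.
Proof.
apply: (big_morph (fun p => poly_map p u i)) => [p q|]; first exact: poly_mapD.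
by rewrite -(scale0r 0) poly_mapZ mul0r.
Qed.

Lemma poly_mapXn k u i : poly_map 'X^k u i = gamma_seq k u i.
Proof.
rewrite /poly_map size_polyXn big_ord_recr /= coefXn eqxx mul1r.
by rewrite big1 ?add0r // => j _; rewrite coefXn ltn_eqF ?mul0r.
Qed.

Lemma poly_map1 u i : poly_map 1 u i = u i.
Proof.
have := poly_mapXn 0 u i; rewrite expr0 => ->.
by rewrite /gamma_seq /gap big_ord0 mul1r muln0 addn0.
Qed.

Lemma poly_mapXnM k p u i :
  poly_map ('X^k * p) u i = gap k u i * poly_map p u (i + 2 * k).
Proof.
rewrite -[p in LHS]coefK poly_def mulr_sumr poly_map_sum [poly_map p u _]/poly_map mulr_sumr.
apply: eq_bigr => l _; rewrite -scalerAr -exprD poly_mapZ poly_mapXn gamma_seqD.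
by rewrite mulrCA.
Qed.

(** * Composition corresponds to multiplication *)

Lemma poly_map_neq0 (p : {poly _}) u i : poly_map p u i != 0 ->
  exists k, [/\ p`_k != 0, u (i + 2 * k)%N != 0 &
    forall j, (j < k)%N -> u (i + 2 * j + 1)%N = 0].
Proof.
move=> nz; have [k /= ] : exists k : 'I_(size p), p`_k * gamma_seq k u i != 0.
  apply/existsP; apply: contraR nz => /existsPn z.
  by rewrite /poly_map big1 // => k _; apply/eqP; have := z k; rewrite negbK.
rewrite !mulf_eq0 !negb_or => /and3P[pk /gap_neq0 gk uk].
by exists k; split.
Qed.

Lemma poly_map_1Dsub q u i : poly_map q u i = u i + poly_map (q - 1) u i.
Proof. by rewrite -{1}(poly_map1 u) -poly_mapD addrC subrK. Qed.

(* If the change at [i] is nonzero, then among the positions after [i] a one at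
   even distance occurs before any one at odd distance; a nonzero image at
   [i + 2t + 1] would require the opposite. *)
Lemma poly_map_blocked (q : {poly _}) u i t : q`_0 = 1 -> poly_map (q - 1) u i != 0 ->
    (forall s, (s < t)%N -> u (i + 2 * s.+1)%N = 0) ->
  poly_map q u (i + 2 * t + 1) = 0.
Proof.
move=> q0 /poly_map_neq0[k [qk uk zk]] zt; apply/eqP/negPn/negP.
move=> /poly_map_neq0[l [_ ul zl]].
have k_gt0 : (0 < k)%N.
  by case: k qk {uk zk} => //; rewrite coefB coef1 q0 subrr eqxx.
have tk : (t < k)%N.
  rewrite ltnNge; apply: contra uk => kt; apply/eqP.
  by have := zt k.-1; rewrite prednK //; apply.
have kl : (k <= t + l)%N.
  rewrite leqNgt; apply: contra ul => lk; apply/eqP.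
  by rewrite -(zk (t + l)%N) //; congr u; lia.
case/negP: uk; apply/eqP; rewrite -(zl (k - t.+1)%N); last by lia.
by congr u; lia.
Qed.

(** The factors are exchanged one at a time. Where [u] and its image differ, either the rest of the
    gap or the final value vanishes. *)
Lemma gap_poly_map (q : {poly _}) u k i : q`_0 = 1 ->
  gap k (poly_map q u) i * poly_map q u (i + 2 * k) =
  gap k u i * poly_map q u (i + 2 * k).
Proof.
move=> q0; elim: k i => [|k IHk] i; first by rewrite /gap !big_ord0.
rewrite !gapS; have -> : (i + 2 * k.+1 = i.+2 + 2 * k)%N by lia.
rewrite -!mulrA IHk (poly_map_1Dsub _ _ i.+1) addrA [LHS]mulrDl.
have [->|Dnz] := eqVneq (poly_map (q - 1) u i.+1) 0; first by rewrite mul0r addr0.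
have [->|/gap_neq0 gnz] := eqVneq (gap k u i.+2) 0; first by rewrite mul0r !mulr0 addr0.
(* The final value sits at odd distance from [i.+1]; the zeros of the remaining gap are at even
   distance from it. *)
have -> : (i.+2 + 2 * k = i.+1 + 2 * k + 1)%N by lia.
rewrite (poly_map_blocked q0 Dnz) ?mulr0 ?addr0 // => s /gnz <-.
by congr u; lia.
Qed.

(** Both sides are linear in [p], which leaves ['X^k]; there the gap of the image is exchanged for
    that of [u]. *)
Lemma poly_map_comp (p q : {poly _}) u i : q`_0 = 1 ->
  poly_map p (poly_map q u) i = poly_map (p * q) u i.
Proof.
move=> q0; rewrite -[in RHS](coefK p) poly_def mulr_suml poly_map_sum.
apply: eq_bigr => k _; rewrite -scalerAl poly_mapZ poly_mapXnM.
by rewrite /gamma_seq gap_poly_map.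
Qed.

Lemma eq_poly_map p u v : u =1 v -> poly_map p u =1 poly_map p v.
Proof.
move=> uv i; apply: eq_bigr => k _; rewrite /gamma_seq uv; congr (_ * (_ * _)).
by apply: eq_bigr => j _; rewrite uv.
Qed.

(** * Periodic sequences and the modulus *)

Section Periodic.

Variables (h : nat) (u : nat -> 'F_2).
Hypothesis u_per : forall i, u (i + 2 * h)%N = u i.

Lemma periodic_mod i : u (i %% (2 * h))%N = u i.
Proof.
rewrite {2}(divn_eq i (2 * h)) addnC; elim: (i %/ _)%N => [|k IHk].
  by rewrite mul0n addn0.
by rewrite IHk -u_per; congr u; lia.
Qed.

Lemma poly_map_periodic p i : poly_map p u (i + 2 * h) = poly_map p u i.
Proof.
apply: eq_bigr => k _; congr (_ * _); rewrite /gamma_seq; congr (_ * _).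
  by apply: eq_bigr => j _; rewrite -[in RHS]u_per; congr (1 + u _); lia.
by rewrite -[in RHS]u_per; congr u; lia.
Qed.

Hypothesis h_gt0 : (0 < h)%N.

(* A run of [h] zeros at odd distance covers the whole other parity class. *)
Lemma gap_period_neq0 i j : gap h u i != 0 -> u (i + 2 * j + 1)%N = 0.
Proof.
move=> /gap_neq0 /(_ (j %% h)%N); rewrite ltn_pmod // => /(_ isT) <-.
rewrite -(periodic_mod (i + 2 * j + 1)) -(periodic_mod (i + 2 * (j %% h) + 1)).
congr u; rewrite {1}(divn_eq j h).
have -> : (i + 2 * (j %/ h * h + j %% h) + 1 =
           j %/ h * (2 * h) + (i + 2 * (j %% h) + 1))%N by lia.
by rewrite modnMDl.
Qed.

(** Here the gap at [i] is 1, so ['X^h] merely shifts by a full period, and two equal terms cancel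
    in characteristic 2. *)
Lemma poly_map_M1DXh_eq0 p i :
  (forall j, u (i + 2 * j + 1)%N = 0) -> poly_map (p * (1 + 'X^h)) u i = 0.
Proof.
move=> z; rewrite mulrDr mulr1 mulrC poly_mapD poly_mapXnM poly_map_periodic.
rewrite /gap big1 ?mul1r => [|j _]; last by rewrite z addr0.
by rewrite -mulr2n -mulr_natl pchar_Zp // mul0r.
Qed.

(** In ['X^h * (1 + 'X^h)] the first factor contributes a gap of length [h]; where that is nonzero,
    the second factor gives 0. *)
Lemma poly_mapM_modulus_eq0 p i :
  poly_map (p * ('X^(2 * h) + 'X^h)) u i = 0.
Proof.
have -> : p * ('X^(2 * h) + 'X^h) = 'X^h * (p * (1 + 'X^h)).
  by rewrite mul2n -addnn exprD; ring.
rewrite poly_mapXnM poly_map_periodic.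
have [->|gnz] := eqVneq (gap h u i) 0; first by rewrite mul0r.
by rewrite poly_map_M1DXh_eq0 ?mulr0 // => j; apply: gap_period_neq0.
Qed.

End Periodic.

(** * Rows as periodic sequences *)

Section Rows.

Variables (n : nat) (n_gt0 : (0 < n)%N).

Definition unroll (x : 'rV['F_2]_n) (i : nat) : 'F_2 :=
  x 0 (Ordinal (ltn_pmod i n_gt0)).

Lemma unroll_ord x (i : 'I_n) : unroll x i = x 0 i.
Proof. by congr (x 0 _); apply/val_inj; rewrite /= modn_small. Qed.

Lemma unroll_eqmod x i j : (i = j %[mod n])%N -> unroll x i = unroll x j.
Proof. by move=> ij; congr (x 0 _); apply/val_inj. Qed.

Lemma iter_shiftE k x (i : 'I_n) :
  iter k (@shift n) x 0 i = unroll x (i + k)%N.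
Proof.
elim: k i => [|k IHk] i; first by rewrite addn0 unroll_ord.
by rewrite iterS mxE IHk; apply: unroll_eqmod; rewrite /= modnDml addSnnS.
Qed.

Lemma gamma_evenE k x (i : 'I_n) :
  gamma_even k x 0 i = gamma_seq k (unroll x) i.
Proof.
case: k => [|k].
  by rewrite /gamma_seq /gap big_ord0 mul1r muln0 addn0 unroll_ord.
rewrite /gamma_even mxE iter_shiftE mulrC; congr (_ * _).
rewrite (big_morph (fun y : 'rV_n => y 0 i) (op1 := *%R) (id1 := 1)); last first.
- by rewrite mxE.
- by move=> y z; rewrite mxE.
by apply: eq_bigr => j _; rewrite !mxE iter_shiftE addnA.
Qed.

Lemma fmapE a x (i : 'I_n) :
  fmap a x 0 i = poly_map (apoly n a) (unroll x) i.
Proof.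
rewrite /fmap mxE gamma_evenE /apoly poly_mapD -poly_mapXn expr0; congr (_ + _).
rewrite summxE poly_map_sum; apply: eq_bigr => k _.
by rewrite mxE gamma_evenE poly_mapZ poly_mapXn.
Qed.

Lemma apoly_coef0 a : (apoly n a)`_0 = 1.
Proof.
rewrite coefD coef1 coef_sum big_nat_cond big1 ?addr0 // => k.
by case/andP=> /andP[k_gt0 _] _; rewrite coefZ coefXn eq_sym gtn_eqF ?mulr0.
Qed.

End Rows.

(** * Bijectivity in even dimension *)

Section EvenRows.

Variables (h : nat) (h_gt0 : (0 < 2 * h)%N).
Let ur := unroll h_gt0.

Lemma unroll_periodic x i : ur x (i + 2 * h) = ur x i.
Proof. by apply: unroll_eqmod; rewrite modnDr. Qed.

Definition row_map (p : {poly 'F_2}) (x : 'rV['F_2]_(2 * h)) :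
  'rV['F_2]_(2 * h) := \row_i poly_map p (ur x) i.

Lemma unroll_row_map p x : ur (row_map p x) =1 poly_map p (ur x).
Proof.
move=> i; rewrite /ur /unroll mxE /= (@periodic_mod h (poly_map p _)) // => j.
exact/poly_map_periodic/unroll_periodic.
Qed.

Lemma row_map_comp (p q : {poly _}) x : q`_0 = 1 ->
  row_map p (row_map q x) = row_map (p * q) x.
Proof.
move=> q0; apply/rowP => i; rewrite !mxE (eq_poly_map _ (unroll_row_map q x)).
exact: poly_map_comp.
Qed.

Lemma fmap_row_map a : @fmap (2 * h) a =1 row_map (apoly (2 * h) a).
Proof. by move=> x; apply/rowP => i; rewrite [RHS]mxE; apply: fmapE. Qed.

Lemma row_map_1D_modulus p x :
  row_map (1 + p * ('X^(2 * h) + 'X^h)) x = x.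
Proof.
have h0 : (0 < h)%N by move: h_gt0; lia.
apply/rowP => i; rewrite mxE poly_mapD poly_map1.
rewrite (poly_mapM_modulus_eq0 (unroll_periodic x) h0) addr0.
exact: unroll_ord.
Qed.

Lemma coprime_fmap_bij a :
  coprimep (apoly (2 * h) a) ('X^(2 * h) + 'X^h) -> bijective (@fmap (2 * h) a).
Proof.
have h0 : (0 < h)%N by move: h_gt0; lia.
set A := apoly _ a; set M := 'X^_ + _ => /Bezout_eq1_coprimepP[[b c] /= bez].
have A0 : A`_0 = 1 by apply: apoly_coef0.
have M0 : M`_0 = 0 by rewrite coefD !coefXn !ltn_eqF // addr0.
(* The map of [b] will be the inverse; composing with it on the inside requires constant term 1. *)
have b0 : b`_0 = 1.
  have := congr1 (fun p : {poly 'F_2} => p`_0) bez.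
  by rewrite /= coefD !coef0M A0 M0 mulr0 addr0 mulr1 coef1.
have bA : b * A = 1 + (- c) * M by rewrite mulNr -bez addrK.
exists (row_map b) => x; rewrite fmap_row_map row_map_comp //.
  by rewrite bA row_map_1D_modulus.
by rewrite mulrC bA row_map_1D_modulus.
Qed.

(* With [c] the cofactor of [gcd(f, 1 + X^h)], the map kills the image under
   [c] of the indicator of position [0], which [c] leaves nonzero unless [c]
   has degree [h]. *)
Lemma fmap_inj_coprime a :
  injective (@fmap (2 * h) a) -> coprimep (apoly (2 * h) a) (1 + 'X^h).
Proof.
have h0 : (0 < h)%N by move: h_gt0; lia.
move=> inj; set A := apoly _ a; set H := 1 + 'X^h.
have H0 : H`_0 = 1 by rewrite coefD coef1 coefXn (ltn_eqF h0) addr0.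
have szH : size H = h.+1 by rewrite /H addrC size_XnaddC.
have [g_dvdA g_dvdH] := (dvdp_gcdl A H, dvdp_gcdr A H).
set g := gcdp A H in g_dvdA g_dvdH *.
have Hnz : H != 0 by rewrite -size_poly_eq0 szH.
have [c Hc] := dvdpP _ _ g_dvdH; have [d Ad] := dvdpP _ _ g_dvdA.
have c0 : c`_0 = 1.
  apply: F2_neq0; apply/eqP => c0; have := H0.
  by rewrite Hc coef0M c0 mul0r => /eqP.
pose e : 'rV['F_2]_(2 * h) := \row_i (i == 0%N :> nat)%:R.
have eE i : ur e i = (2 * h %| i)%N%:R by rewrite /ur /unroll mxE.
have e_odd (i j : nat) : ~~ odd i -> ur e (i + 2 * j + 1)%N = 0.
  move=> i_even; rewrite eE; case: dvdnP => // -[k] /(congr1 odd).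
  by rewrite addn1 /= !mul2n oddD oddM !odd_double (negPf i_even) andbF.
have e_map0 (p : {poly 'F_2}) i : odd i -> poly_map p (ur e) i = 0.
  move=> i_odd; apply: big1 => k _; rewrite /gamma_seq.
  have -> : (i + 2 * k = i.-1 + 2 * k + 1)%N by case: i i_odd => // i _; lia.
  by rewrite e_odd ?mulr0 //; case: i i_odd.
have map0 p : row_map p 0 = 0.
  apply/rowP => i; rewrite !mxE; apply: big1 => k _.
  by rewrite /gamma_seq {2}/ur /unroll mxE !mulr0.
have ce0 : row_map c e = 0.
  (* Since [A * c = d * H], the image vanishes: at odd positions by the support of [e], at even ones
     because [e] has no ones at odd distance. *)
  apply: inj; rewrite !fmap_row_map map0 row_map_comp // -/A Ad -mulrA.
  rewrite [g * c]mulrC -Hc; apply/rowP => i; rewrite !mxE.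
  have [/e_map0->//|i_even] := boolP (odd i).
  rewrite poly_map_M1DXh_eq0 // => [k|k]; first exact: unroll_periodic.
  exact: e_odd.
have: poly_map c (ur e) 0 = 0.
  by rewrite -unroll_row_map ce0 /ur /unroll mxE.
rewrite /coprimep -/g => c_e0; apply/negPn/negP => g_neq1.
have szc : (size c <= h)%N.
  have [cnz gnz] : c != 0 /\ g != 0.
    by apply/andP; rewrite -negb_or -mulf_eq0 -Hc.
  have := szH; rewrite Hc size_mul // => szcg.
  move: g_neq1; rewrite -size_poly_eq0 in gnz; move: szcg gnz.
  by case: (size g) => [|[|m]] // + _ _; rewrite !addnS => -[<-]; apply: leq_addr.
(* The terms at position 0 read [e] at [2 * k] with [k < h], so only the constant coefficient of [c]
   survives, and it is 1. *)
move: c_e0; rewrite (@poly_map_widen h) //.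
rewrite (bigD1 (Ordinal h0)) //= big1 => [|k k_neq0].
  rewrite c0 /gamma_seq /gap big_ord0 eE muln0 dvdn0 !mul1r addr0 => /eqP.
  by rewrite oner_eq0.
rewrite /gamma_seq eE dvdn_pmul2l // gtnNdvd ?mulr0 // lt0n.
by apply: contraNneq k_neq0 => k0; apply/eqP/val_inj.
Qed.

End EvenRows.

(** * Coprimality over ['F_2] and the quotient ring *)

Lemma pchar_polyF2 : 2%N \in [pchar {poly 'F_2}].
Proof. by rewrite pchar_poly; apply: pchar_Fp. Qed.

Lemma gcdp_F2_eq1 (p q : {poly 'F_2}) : gcdp p q = 1 <-> coprimep p q.
Proof.
rewrite /coprimep; split=> [->|/size_poly1P[c cnz ->]]; first by rewrite size_poly1.
by rewrite (F2_neq0 cnz).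
Qed.

Lemma largest_odd_divisorE n : (0 < n)%N ->
  n = (largest_odd_divisor n * 2 ^ logn 2 n)%N.
Proof.
move=> n_gt0; have [m] := pfactor_coprime (isT : prime 2) n_gt0.
rewrite coprime2n => m_odd nE; rewrite [LHS]nE; congr (_ * _)%N; apply/eqP.
have m_dvd : (m %| n)%N by rewrite nE dvdn_mulr.
rewrite eqn_leq /largest_odd_divisor; apply/andP; split.
  by apply: (bigmaxn_sup_seq m) => //; rewrite -dvdn_divisors.
apply/bigmax_leqP_seq => d; rewrite -dvdn_divisors // nE => d_dvd d_odd.
rewrite Gauss_dvdl ?coprimeXr ?coprimen2 // in d_dvd.
by apply: dvdn_leq => //; case: m m_odd {nE m_dvd d_dvd}.
Qed.

(** By Frobenius, [1 + 'X^(m * 2 ^ s)] is a power of [1 + 'X^m]. *)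
Lemma coprimep_1DXn_expn2 (p : {poly 'F_2}) m s :
  coprimep p (1 + 'X^(m * 2 ^ s)) = coprimep p (1 + 'X^m).
Proof.
rewrite exprM -{1}(expr1n _ (2 ^ s)%N) -exprDn_pchar; last first.
  by rewrite (eq_pnat _ (pcharf_eq pchar_polyF2)) pnatX pnat_id.
by rewrite coprimep_pexpr // expn_gt0.
Qed.

(** The extra factor ['X^h] is coprime to [p], as 0 is not a root of [p]. *)
Lemma coprimep_modulus (p : {poly 'F_2}) h : (0 < h)%N -> p`_0 = 1 ->
  coprimep p ('X^(2 * h) + 'X^h) = coprimep p (1 + 'X^h).
Proof.
move=> h_gt0 p0.
have -> : 'X^(2 * h) + 'X^h = 'X^h * (1 + 'X^h) :> {poly 'F_2}.
  by rewrite mul2n -addnn exprD; ring.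
rewrite coprimepMr coprimep_pexpr // coprimepX.
by rewrite /root horner_coef0 p0 oner_eq0.
Qed.

(** Units of the quotient are defined by coprimality with [mk_monic M], which is [M] under these
    hypotheses. *)
Lemma unit_in_qpoly (F : fieldType) (M p : {poly F}) :
  M \is monic -> (1 < size M)%N ->
  (in_qpoly M p \is a GRing.unit) = coprimep p M.
Proof.
move=> M_monic sz_M; rewrite coprimep_sym.
have ME : mk_monic M = M by rewrite /mk_monic M_monic sz_M.
rewrite -[LHS]/(coprimep (mk_monic M) (Pdiv.CommonRing.rmodp p (mk_monic M))) ME.
by rewrite -Pdiv.IdomainMonic.modpE // coprimep_modr.
Qed.

(* gcdp is only determined up to a nonzero scalar in general; over 'F_2 the
   only such scalar is 1, so equalities between gcds are literal ones.  For
   n > 0 the modulus is monic and nonconstant, so that {poly %/ _} is the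
   quotient by that very polynomial. *)
Theorem theorem9 (n : nat) (n_gt0 : (0 < n)%N) (n_even : ~~ odd n)
    (a : nat -> 'F_2) :
  (bijective (@fmap n a) <->
     in_qpoly ('X^n + 'X^(n %/ 2)) (apoly n a) \is a GRing.unit)
  /\
  (bijective (@fmap n a) <->
     gcdp (apoly n a) (1 + 'X^(n %/ 2))
       = gcdp (apoly n a) (1 + 'X^(largest_odd_divisor n)) /\
     gcdp (apoly n a) (1 + 'X^(largest_odd_divisor n)) = 1).
Proof.
pose h := (n %/ 2)%N; have nE : n = (2 * h)%N by rewrite mulnC divnK ?dvdn2.
have h_gt0 : (0 < h)%N by lia.
rewrite -/h; set m := largest_odd_divisor n.
have hE : h = (m * 2 ^ (logn 2 n).-1)%N.
  have logn_gt0 : (0 < logn 2 n)%N by rewrite logn_gt0 mem_primes /= n_gt0 dvdn2.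
  rewrite /h {1}(largest_odd_divisorE n_gt0) -/m -{1}(prednK logn_gt0) expnSr mulnA.
  by rewrite mulnK.
set A := apoly n a; have A0 : A`_0 = 1 by apply: apoly_coef0.
have bijE : bijective (@fmap n a) <-> coprimep A (1 + 'X^h).
  rewrite /A {A A0 m hE}; move: (n) nE n_gt0 => _ -> n_gt0.
  split=> [/bij_inj/fmap_inj_coprime|]; first exact.
  by rewrite -coprimep_modulus ?apoly_coef0 //; apply: coprime_fmap_bij.
have cop_m : coprimep A (1 + 'X^h) = coprimep A (1 + 'X^m).
  by rewrite hE coprimep_1DXn_expn2.
split; apply: iff_trans bijE _.
  have szM : size ('X^n + 'X^h : {poly 'F_2}) = n.+1.
    by rewrite size_polyDl size_polyXn // size_polyXn nE; lia.
  rewrite unit_in_qpoly ?szM //; first by rewrite nE coprimep_modulus.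
  by rewrite monicE lead_coefDl ?lead_coefXn // !size_polyXn nE; lia.
rewrite !gcdp_F2_eq1 -cop_m; split=> [cop|[]//].
split=> //; have /gcdp_F2_eq1 -> := cop.
by move: cop; rewrite cop_m => /gcdp_F2_eq1 ->.
Qed.
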